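(* Let $(\mathbf X,\mathbf Y)=\{(X^n,Y^n)\}_{n\ge1}$ be a general correlated source. For any $\varepsilon\in[0,1)$, \[(1-\varepsilon)\underline H(\mathbf X|\mathbf Y)\le R^\varepsilon_{com}(\mathbf X|\mathbf Y)\le(1-\varepsilon)\overline H(\mathbf X|\mathbf Y).\]
   Context: A general correlated source $(\mathbf X,\mathbf Y)=\{(X^n,Y^n)\}_{n\ge1}$ is an arbitrary sequence of pairs of random variables, $(X^n,Y^n)$ taking values in $\mathcal X^n\times\mathcal Y^n$ with $\mathcal X,\mathcal Y$ finite or countably infinite, with joint distribution $P_{X^nY^n}$ (no structural assumptions). Logarithms are base 2. For real random variables $Z_n$: $\mathrm{p\text{-}limsup}_n Z_n=\inf\{\alpha:\lim_n\Pr\{Z_n>\alpha\}=0\}$ and $\mathrm{p\text{-}liminf}_n Z_n=\sup\{\beta:\lim_n\Pr\{Z_n<\beta\}=0\}$. Define $\overline H(\mathbf X|\mathbf Y)=\mathrm{p\text{-}limsup}_n\frac1n\log\frac1{P_{X^n|Y^n}(X^n|Y^n)}$ and $\underline H(\mathbf X|\mathbf Y)=\mathrm{p\text{-}liminf}_n\frac1n\log\frac1{P_{X^n|Y^n}(X^n|Y^n)}$. Coding with common side-information: a code of blocklength $n$ is $(\varphi_n,\psi_n)$ with encoder $\varphi_n:\mathcal X^n\times\mathcal Y^n\to\{0,1\}^*$ such that for each $y^n$ the set $\{\varphi_n(x^n|y^n):x^n\}$ is prefix-free, and decoder $\psi_n:\{0,1\}^*\times\mathcal Y^n\to\mathcal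 X^n$; error probability $\Pr\{\psi_n(\varphi_n(X^n|Y^n),Y^n)\ne X^n\}$; $\ell_n(x^n|y^n)$ is the length of $\varphi_n(x^n|y^n)$. $R$ is $\varepsilon$-achievable if there are codes with $\limsup_n$ error probability $\le\varepsilon$ and $\limsup_n\frac1n\mathbb E[\ell_n(X^n|Y^n)]\le R$; $R^\varepsilon_{com}(\mathbf X|\mathbf Y)$ is the infimum of $\varepsilon$-achievable rates. *)

(* Defs.v *)
From HB Require Import structures.
From mathcomp Require Import all_boot all_order all_algebra.
From mathcomp Require Import all_classical all_reals all_analysis.
Set Implicit Arguments. Unset Strict Implicit. Unset Printing Implicit Defensive.
Import Order.TTheory GRing.Theory Num.Theory.
Local Open Scope classical_set_scope.
Local Open Scope ring_scope.

Section Source.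
Variables (R : realType) (X Y : countType).

Definition jpmf n := (n.-tuple X * n.-tuple Y)%type -> R.

Definition is_pmf (T : choiceType) (p : T -> R) :=
  (forall z, 0 <= p z) /\ (\esum_(z in [set: T]) (p z)%:E = 1%E).

Definition is_source (P : forall n, jpmf n) := forall n, is_pmf (P n).

Definition Pr n (P : forall n, jpmf n) (E : set (n.-tuple X * n.-tuple Y)) : \bar R :=
  \esum_(z in E) (P n z)%:E.

Definition log2 (x : R) : R := ln x / ln 2.

Definition PY (P : forall n, jpmf n) n (y : n.-tuple Y) : R :=
  fine (\esum_(x in [set: n.-tuple X]) (P n (x, y))%:E).

Definition Pcond (P : forall n, jpmf n) n (z : n.-tuple X * n.-tuple Y) : R :=
  P n z / PY P z.2.

Definition info (P : forall n, jpmf n) n (z : n.-tuple X * n.-tuple Y) : R :=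
  n%:R^-1 * log2 (Pcond P z)^-1.

Definition cond_ent_sup (P : forall n, jpmf n) : \bar R :=
  ereal_inf [set a%:E | a in [set a : R |
     (fun n => @Pr n P [set z | info P z > a]) @ \oo --> 0%E]].

Definition cond_ent_inf (P : forall n, jpmf n) : \bar R :=
  ereal_sup [set b%:E | b in [set b : R |
     (fun n => @Pr n P [set z | info P z < b]) @ \oo --> 0%E]].

Definition encoder n := n.-tuple X -> n.-tuple Y -> seq bool.
Definition decoder n := seq bool -> n.-tuple Y -> n.-tuple X.

Definition prefix_free_enc n (phi : encoder n) :=
  forall y x x', prefix (phi x y) (phi x' y) -> phi x y = phi x' y.

Definition err_prob (P : forall n, jpmf n) n (phi : encoder n) (psi : decoder n) : \bar R :=
  Pr P [set z | psi (phi z.1 z.2) z.2 != z.1].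

Definition exp_len (P : forall n, jpmf n) n (phi : encoder n) : \bar R :=
  \esum_(z in [set: n.-tuple X * n.-tuple Y]) ((P n z) * (size (phi z.1 z.2))%:R)%:E.

Definition achievable (P : forall n, jpmf n) (eps r : R) :=
  exists (phi : forall n, encoder n) (psi : forall n, decoder n),
    (forall n, prefix_free_enc (phi n)) /\
    (limn_esup (fun n => err_prob P (phi n) (psi n)) <= eps%:E)%E /\
    (limn_esup (fun n => (n%:R^-1)%:E * exp_len P (phi n))%E <= r%:E)%E.

Definition Rcom (P : forall n, jpmf n) (eps : R) : \bar R :=
  ereal_inf [set r%:E | r in [set r : R | achievable P eps r]].

End Source.

(* Main.v *)
(** Lower bound: an injective assignment gives words of length at most k to fewer
    than 2^(k+1) sequences for each y. If the information rate is at least b, each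
    such sequence has conditional probability at most 2^(-nb), so words of length at
    most n(b - d) are correctly decoded with probability at most 2 * 2^(-nd). All
    other correct words are longer than n(b - d), and Markov's inequality gives the
    rate (1 - eps)(b - d).

    Upper bound: if the information rate is at most a with probability tending to 1,
    each y has at most 2^(na) such sequences, which get a flag bit and a fixed-length
    index. To save the factor 1 - eps, a set G of typical pairs of probability at
    most eps, which one more atom z0 would push above eps, is sacrificed: G and z0
    get the one-letter word, which is decoded as z0, so that the error is at most eps
    while long words occur with probability below 1 - eps. *)
Require Import Defs.
From HB Require Import structures.
From mathcomp Require Import all_boot all_order all_algebra.
From mathcomp Require Import finmap lra ring zify.
From mathcomp Require Import all_classical all_reals all_analysis.
Set Implicit Arguments. Unset Strict Implicit. Unset Printing Implicit Defensive.
Import Order.TTheory GRing.Theory Num.Theory.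
Local Open Scope ring_scope.

(** * Extended sums through duplicate-free lists *)

Section Sums.
Local Open Scope classical_set_scope.
Variables (R : realType) (T : choiceType).
Implicit Types (A B : set T) (a : T -> \bar R).

(** [\esum] is a supremum over finite sets; duplicate-free lists replace them here, so that counting
    and list induction become available. *)
Lemma esum_le_seq A a (M : \bar R) :
  (forall s : seq T, uniq s -> (forall x, x \in s -> A x) ->
     (\sum_(x <- s) a x <= M)%E) ->
  (\esum_(x in A) a x <= M)%E.
Proof.
move=> h; apply: ge_ereal_sup => _ [F [finF FA] <-].
rewrite fsbig_finite //; apply: h; first exact: fset_uniq.
by move=> x; rewrite in_fset_set // inE => /FA.
Qed.

Lemma seq_le_esum A a (s : seq T) : uniq s -> (forall x, x \in s -> A x) ->
  (\sum_(x <- s) a x <= \esum_(x in A) a x)%E.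
Proof.
move=> us sA; rewrite fsbig_seq //; apply: ereal_sup_ubound.
exists [set` s] => //; split=> [|x /= /sA //]; exact: finite_seq.
Qed.

Lemma esumZ A a (c : R) : 0 <= c -> (forall x, A x -> 0 <= a x)%E ->
  \esum_(x in A) (c%:E * a x)%E = (c%:E * \esum_(x in A) a x)%E.
Proof.
move=> c0 a0; rewrite /esum -ereal_supZl //; last first.
  by apply/set0P; exists (\sum_(x \in set0) a x)%E; exists set0 => //; exact: fsets_set0.
congr ereal_sup; rewrite image_comp; apply: eq_imagel => F [finF FA] /=.
rewrite !fsbig_finite //= big_seq [in RHS]big_seq ge0_sume_distrr //.
by move=> x; rewrite in_fset_set // inE => /FA/a0.
Qed.

Lemma subset_esum A B a : A `<=` B -> (forall x, 0 <= a x)%E ->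
  (\esum_(x in A) a x <= \esum_(x in B) a x)%E.
Proof.
move=> AB a0; apply: esum_le_seq => s us sA.
by apply: seq_le_esum => // x /sA /AB.
Qed.

(** A list of maximal length is exhaustive, since a missing element could be prepended to it. *)
Lemma exists_enum_of_bounded A (M : nat) :
  (forall s : seq T, uniq s -> (forall x, x \in s -> A x) -> (size s <= M)%N) ->
  exists s : seq T, [/\ uniq s, (forall x, x \in s <-> A x) & (size s <= M)%N].
Proof.
move=> h; pose Q k := `[< exists s : seq T,
  [/\ uniq s, (forall x, x \in s -> A x) & size s = k] >].
have exQ : exists k, Q k by exists 0%N; apply/asboolP; exists [::].
have ubQ k : Q k -> (k <= M)%N by move=> /asboolP[s [us sA <-]]; exact: h.
case: (ex_maxnP exQ ubQ) => k /asboolP[s [us sA sk]] kmax.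
exists s; split => //; last exact: h.
move=> x; split=> [/sA //|Ax]; apply/negPn/negP => xs.
suff : (k.+1 <= k)%N by rewrite ltnn.
apply: kmax; apply/asboolP; exists (x :: s); split => //=.
- by rewrite xs.
- by move=> z; rewrite inE => /predU1P[->|/sA].
- by rewrite sk.
Qed.

End Sums.

(** * Limits superior and eventual bounds *)

Section LimSup.
Local Open Scope classical_set_scope.
Variable R : realType.
Implicit Types (u : nat -> \bar R) (r e : R).

(** The limit superior is an infimum of suprema over eventual sets, and the set where the bound
    holds is one of them. *)
Lemma limn_esup_le_of_near u r :
  (forall e, 0 < e -> \forall n \near \oo, (u n <= (r + e)%:E)%E) ->
  (limn_esup u <= r%:E)%E.
Proof.
move=> h; apply/lee_addgt0Pr => e e0; rewrite -EFinD.
apply: (@le_trans _ _ (ereal_sup (u @` [set n | (u n <= (r + e)%:E)%E]))).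
  apply: ereal_inf_lbound; exists [set n | (u n <= (r + e)%:E)%E] => //.
  exact: h.
by apply: ge_ereal_sup => _ [n /= ? <-].
Qed.

Lemma near_le_of_limn_esup u r e : (limn_esup u <= r%:E)%E -> 0 < e ->
  \forall n \near \oo, (u n <= (r + e)%:E)%E.
Proof.
move=> h e0.
have /ereal_inf_lt[_ [V VF <-] hV] : (limn_esup u < (r + e)%:E)%E.
  by apply: (le_lt_trans h); rewrite lte_fin ltrDl.
apply: filterS VF => n Vn; apply: le_trans (ltW hV).
by apply: ereal_sup_ubound; exists n.
Qed.

Lemma near_le_of_cvge0 u e : u @ \oo --> 0%E -> 0 < e ->
  \forall n \near \oo, (u n <= e%:E)%E.
Proof.
move=> h e0; have : nbhs (0%E : \bar R) [set x | (x <= e%:E)%E].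
  exists e => //= x /=; rewrite sub0r normrN => xe.
  by rewrite lee_fin; apply: ltW; apply: le_lt_trans xe; exact: ler_norm.
by move=> /h.
Qed.

Lemma exprn_near_le (c x e : R) : 0 <= x < 1 -> 0 < c -> 0 < e ->
  \forall n \near \oo, c * x ^+ n <= e.
Proof.
move=> /andP[x0 x1] c0 e0.
have /cvgrPdist_le/(_ (e / c)) : (fun n => x ^+ n) @ \oo --> 0.
  by apply: cvg_expr; rewrite ger0_norm.
move=> /(_ (divr_gt0 e0 c0)); apply: filterS => n.
by rewrite sub0r normrN ger0_norm ?exprn_ge0 // ler_pdivlMr // mulrC.
Qed.

End LimSup.

(** * Real-valued probability of events *)

Section Mass.
Local Open Scope classical_set_scope.
Variables (R : realType) (T : choiceType) (p : T -> R).
Hypothesis hp : is_pmf p.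
Implicit Types A B : set T.

Definition mass A : R := fine (\esum_(z in A) (p z)%:E).

Let pE0 z : (0 <= (p z)%:E)%E.
Proof. by rewrite lee_fin; exact: hp.1. Qed.

Lemma massE A : \esum_(z in A) (p z)%:E = (mass A)%:E.
Proof.
rewrite /mass fineK // ge0_fin_numE; last by apply: esum_ge0.
apply: (@le_lt_trans _ _ 1%E); last exact: ltry.
by rewrite -hp.2; apply: subset_esum.
Qed.

Lemma mass_ge0 A : 0 <= mass A.
Proof. by rewrite -lee_fin -massE; apply: esum_ge0. Qed.

Lemma massT : mass setT = 1.
Proof. by rewrite /mass hp.2. Qed.

Lemma mass_le A B : A `<=` B -> mass A <= mass B.
Proof. by move=> AB; rewrite -lee_fin -!massE; apply: subset_esum. Qed.

Lemma mass_le1 A : mass A <= 1.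
Proof. by rewrite -massT; apply: mass_le. Qed.

Lemma massID B A : mass A = mass (A `&` B) + mass (A `&` ~` B).
Proof. by apply: EFin_inj; rewrite EFinD -!massE (esumID B). Qed.

Lemma massC A : mass (~` A) = 1 - mass A.
Proof. by rewrite -massT (massID A setT) !setTI addrC addKr. Qed.

Lemma massU_le A B : mass (A `|` B) <= mass A + mass B.
Proof.
rewrite (massID A); apply: lerD; apply: mass_le => z [].
  by [].
by case.
Qed.

Lemma mass_eq0 A : (forall z, A z -> p z = 0) -> mass A = 0.
Proof. by move=> h; rewrite /mass esum1 // => z /h ->. Qed.

Lemma mass_seq (s : seq T) : uniq s -> mass [set` s] = \sum_(z <- s) p z.
Proof.
move=> us; apply: EFin_inj; rewrite -massE.
rewrite esum_fset; [|exact: finite_seq|by []].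
by rewrite -(fsbig_seq _ _ us) sumEFin.
Qed.

(** Markov's inequality; the right side stays extended because an expected length may be
    infinite. *)
Lemma markov_esum A (f : T -> R) (c : R) : 0 <= c ->
  (forall z, 0 <= f z) -> (forall z, A z -> c <= f z) ->
  ((c * mass A)%:E <= \esum_(z in setT) (p z * f z)%:E)%E.
Proof.
move=> c0 f0 cf; rewrite EFinM -massE -esumZ //.
apply: (@le_trans _ _ (\esum_(z in A) (p z * f z)%:E)).
  apply: le_esum => z /cf h; rewrite -EFinM lee_fin mulrC.
  by apply: ler_wpM2l => //; exact: hp.1.
apply: subset_esum => // z; rewrite lee_fin; apply: mulr_ge0 => //; exact: hp.1.
Qed.

(* [A] is filled atom by atom; [z] is the atom that crosses the level [e]. *)
Lemma exists_critical_atom A (e : R) : 0 <= e -> e < mass A ->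
  exists (G : set T) (z : T), [/\ mass G <= e, e < mass (G `|` [set z])
    & G `|` [set z] `<=` A].
Proof.
move=> e0 eA.
have [s [us sA es]] : exists s : seq T,
    [/\ uniq s, (forall x, x \in s -> A x) & e < \sum_(z <- s) p z].
  apply: contrapT => hn; move: eA; apply/negP; rewrite -leNgt -lee_fin -massE.
  apply: esum_le_seq => s us sA; rewrite sumEFin lee_fin leNgt; apply/negP => h.
  by apply: hn; exists s.
elim: s us sA es => [|z s IH] /=; first by rewrite big_nil ltNge e0.
move=> /andP[zs us] sA; case: (ltP e (\sum_(w <- s) p w)) => [h _|h].
  by apply: IH => // x xs; apply: sA; rewrite inE xs orbT.
move=> hz; exists [set` s], z; rewrite mass_seq //; split => //.
  have -> : [set` s] `|` [set z] = [set` z :: s].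
    apply/seteqP; split=> w /=; rewrite inE.
      by case=> [->|->]; rewrite ?eqxx ?orbT.
    by move=> /predU1P[->|]; [right|left].
  by rewrite mass_seq //= zs.
by move=> w [ws|->]; apply: sA; rewrite inE ?eqxx // (ws : w \in s) orbT.
Qed.

End Mass.

(** * Fibers over the side information and conditional information rates *)

Section Conditional.
Local Open Scope classical_set_scope.
Variables (R : realType) (X Y : countType) (P : forall n, jpmf R X Y n).
Arguments P : clear implicits.
Hypothesis hP : is_source P.
Variable n : nat.
Implicit Types (x : n.-tuple X) (y : n.-tuple Y) (z : n.-tuple X * n.-tuple Y).

Lemma PrE (E : set (n.-tuple X * n.-tuple Y)) : Pr P E = (mass (P n) E)%:E.
Proof. exact: massE. Qed.

Lemma P_ge0 z : 0 <= P n z. Proof. exact: (hP n).1. Qed.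

Lemma sum_fiber_esum y (s : seq (n.-tuple X)) : uniq s ->
  ((\sum_(x <- s) P n (x, y))%:E <=
     \esum_(x in [set: n.-tuple X]) (P n (x, y))%:E)%E.
Proof. by move=> us; rewrite -sumEFin; apply: seq_le_esum. Qed.

Lemma esum_swap (a : n.-tuple X * n.-tuple Y -> \bar R) :
  (forall z, 0 <= a z)%E ->
  \esum_(z in setT) a z = \esum_(y in [set: n.-tuple Y])
     \esum_(x in [set: n.-tuple X]) a (x, y).
Proof.
move=> a0; rewrite esum_esum //.
rewrite (reindex_esum (setT `*`` (fun=> setT)) setT (fun w => (w.2, w.1))) //.
split => //=.
  by move=> [i j] [i' j'] /= _ _ [-> ->].
by move=> [x y] _; exists (y, x).
Qed.

(** The [fine] in [PY] discards nothing: a fiber is one term of a double sum of total 1. *)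
Lemma PYE y : \esum_(x in [set: n.-tuple X]) (P n (x, y))%:E = (PY P y)%:E.
Proof.
rewrite /PY fineK // ge0_fin_numE; last first.
  by apply: esum_ge0 => x _; rewrite lee_fin P_ge0.
apply: (@le_lt_trans _ _ 1%E); last exact: ltry.
rewrite -(hP n).2 esum_swap; last by move=> z; rewrite lee_fin P_ge0.
rewrite -(@esum_set1 R _ y (fun y' => \esum_(x in [set: n.-tuple X]) (P n (x, y'))%:E)).
  apply: subset_esum => // y'; apply: esum_ge0 => x _; rewrite lee_fin; exact: P_ge0.
by apply: esum_ge0 => x _; rewrite lee_fin; exact: P_ge0.
Qed.

Lemma PY_ge0 y : 0 <= PY P y.
Proof. by rewrite -lee_fin -PYE; apply: esum_ge0 => x _; rewrite lee_fin P_ge0. Qed.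

Lemma esum_PY : \esum_(y in [set: n.-tuple Y]) (PY P y)%:E = 1%E.
Proof.
rewrite -(hP n).2 esum_swap; last by move=> z; rewrite lee_fin P_ge0.
by apply: eq_esum => y _; rewrite PYE.
Qed.

Lemma sum_fiber_le_PY y (s : seq (n.-tuple X)) : uniq s ->
  \sum_(x <- s) P n (x, y) <= PY P y.
Proof. by move=> us; rewrite -lee_fin -PYE; apply: sum_fiber_esum. Qed.

Lemma P_le_PY z : P n z <= PY P z.2.
Proof. by case: z => x y; have := @sum_fiber_le_PY y [:: x] isT; rewrite big_seq1. Qed.

Lemma ln2_gt0 : 0 < ln (2 : R).
Proof. by apply: ln_gt0; rewrite ltr1n. Qed.

Lemma infoE z : 0 < P n z ->
  info P z = n%:R^-1 * (- ln (P n z / PY P z.2) / ln 2).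
Proof.
move=> Pz; have PYz := lt_le_trans Pz (P_le_PY z).
by rewrite /info /log2 /Pcond lnV // posrE divr_gt0.
Qed.

Lemma powR2E (x : R) : 2 `^ x = expR (x * ln 2).
Proof. by rewrite /powR pnatr_eq0. Qed.

(** Multiplicative form of the threshold. Positivity matters: as [ln 0 = 0], a null atom has
    information rate 0 instead of infinity. *)
Lemma info_le z a : (0 < n)%N -> 0 < P n z ->
  (info P z <= a) = (2 `^ (- (n%:R * a)) * PY P z.2 <= P n z).
Proof.
move=> n0 Pz; have PYz := lt_le_trans Pz (P_le_PY z).
rewrite infoE // ler_pdivrMl ?ltr0n // ler_pdivrMr ?ln2_gt0 // lerNl -mulNr.
rewrite -[RHS]ler_pdivlMr // powR2E -[X in _ = (_ <= X)]lnK ?posrE ?divr_gt0 //.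
by rewrite ler_expR.
Qed.

Lemma info_ge z b : (0 < n)%N -> 0 < P n z ->
  (b <= info P z) = (P n z <= 2 `^ (- (n%:R * b)) * PY P z.2).
Proof.
move=> n0 Pz; have PYz := lt_le_trans Pz (P_le_PY z).
rewrite infoE // ler_pdivlMl ?ltr0n // ler_pdivlMr ?ln2_gt0 // lerNr -mulNr.
rewrite -[RHS]ler_pdivrMr // powR2E -[X in _ = (X <= _)]lnK ?posrE ?divr_gt0 //.
by rewrite ler_expR.
Qed.

Lemma info_ge0 z : (0 < n)%N -> 0 < P n z -> 0 <= info P z.
Proof. by move=> n0 Pz; rewrite info_ge // mulr0 oppr0 powRr0 mul1r P_le_PY. Qed.

End Conditional.

(** * Counting short words; the lower bound at a fixed blocklength *)

Fixpoint words_upto k : seq (seq bool) :=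
  if k is k'.+1 then
    [::] :: (map (cons true) (words_upto k') ++ map (cons false) (words_upto k'))
  else [:: [::]].

Lemma size_words_upto k : (size (words_upto k)).+1 = (2 ^ k.+1)%N.
Proof. by elim: k => //= k IH; rewrite size_cat !size_map [in RHS]expnS -IH; lia. Qed.

Lemma mem_words_upto k (w : seq bool) : (size w <= k)%N -> w \in words_upto k.
Proof.
elim: k w => [|k IH] [|b w] //= wk; rewrite inE mem_cat.
have inj c : injective (cons c : seq bool -> _) by move=> ? ? [].
by case: b; rewrite (mem_map (inj _)) IH // orbT.
Qed.

Section Converse.
Local Open Scope classical_set_scope.
Variables (R : realType) (X Y : countType) (P : forall n, jpmf R X Y n).
Arguments P : clear implicits.
Hypothesis hP : is_source P.
Variable n : nat.
Hypothesis n_gt0 : (0 < n)%N.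
Variables (phi : encoder X Y n) (psi : decoder X Y n).

(* Only the injectivity of [phi] on correctly decoded sequences matters here:
   there are fewer than [2 ^ k.+1] words of length at most [k], prefix-free or not. *)
Lemma mass_correct_short_le (b : R) (k : nat) :
  mass (P n) [set z | [/\ psi (phi z.1 z.2) z.2 = z.1, (size (phi z.1 z.2) <= k)%N
                        & b <= info P z]]
  <= 2 `^ (- (n%:R * b)) * (2 ^ k.+1)%:R.
Proof.
set S := [set z | _]; set c := 2 `^ _.
have c0 : 0 <= c by exact: powR_ge0.
rewrite -lee_fin -(massE (hP n)) esum_mkcond esum_swap; last first.
  by move=> z; case: ifP => // _; rewrite lee_fin P_ge0.
(* The bound is proved on each fiber with weight [PY P y]; these weights sum to 1. *)
apply: (@le_trans _ _ (\esum_(y in [set: n.-tuple Y])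
    ((c * (2 ^ k.+1)%:R)%:E * (PY P y)%:E)%E)).
  apply: le_esum => y _; apply: esum_le_seq => s us _.
  rewrite -big_mkcond -big_filter; set t := [seq x <- s | _].
  have tS x : x \in t -> S (x, y) by rewrite mem_filter => /andP[/set_mem].
  have ut : uniq t by rewrite filter_uniq.
  have st : (size t <= 2 ^ k.+1)%N.
    rewrite -size_words_upto ltnW // ltnS -(size_map (fun x => phi x y)).
    apply: uniq_leq_size.
      rewrite map_inj_in_uniq // => x x' /tS[/= ex _ _] /tS[/= ex' _ _] e.
      by rewrite -ex -ex' e.
    by move=> _ /mapP[x /tS[/= _ h _] ->]; exact: mem_words_upto.
  rewrite sumEFin -EFinM lee_fin.
  apply: (@le_trans _ _ (\sum_(x <- t) c * PY P y)).
    rewrite big_seq [leRHS]big_seq; apply: ler_sum => x /tS[_ _ /= hb].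
    case: (ltP 0 (P n (x, y))) => [Pz|Pz].
      by rewrite -(info_ge hP b n_gt0 Pz).
    by apply: (le_trans Pz); rewrite mulr_ge0 // PY_ge0.
  rewrite big_const_seq count_predT iter_addr_0 -[leLHS]mulr_natr mulrAC.
  by apply: ler_wpM2r; rewrite ?PY_ge0 // ler_wpM2l // ler_nat.
rewrite esumZ ?esum_PY ?mule1 //; first by rewrite mulr_ge0.
by move=> y _; rewrite lee_fin PY_ge0.
Qed.

(** A union bound over four cases (error, low information, short and correct, long) bounds the
    probability of long words from below; Markov's inequality then applies. *)
Lemma exp_len_ge (b d : R) : d <= b -> 0 <= d ->
  (((b - d) * (1 - mass (P n) [set z | psi (phi z.1 z.2) z.2 != z.1]
     - mass (P n) [set z | info P z < b] - 2 * (2 `^ (- d)) ^+ n))%:E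
   <= (n%:R^-1)%:E * exp_len P phi)%E.
Proof.
move=> db d0; set Er := [set z | psi _ _ != _]; set I := [set z | info P z < b].
have bd0 : 0 <= n%:R * (b - d) by rewrite mulr_ge0 ?subr_ge0.
(* Rounding down keeps [2 ^ k] below [2 ^ (n (b - d))], while a length above [k] still exceeds
   [n (b - d)]. *)
set k := Num.truncn (n%:R * (b - d)).
set S := [set z | [/\ psi (phi z.1 z.2) z.2 = z.1, (size (phi z.1 z.2) <= k)%N
                        & b <= info P z]].
set D := [set z : n.-tuple X * n.-tuple Y | (k < size (phi z.1 z.2))%N].
have cover : 1 <= mass (P n) Er + mass (P n) I + mass (P n) S + mass (P n) D.
  rewrite -(massT (hP n)) (_ : setT = Er `|` I `|` S `|` D).
    do 3 (apply: (le_trans (massU_le (hP n) _ _)); apply: lerD => //).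
  apply/esym/seteqP; split => // z _.
  case: (ltnP k (size (phi z.1 z.2))) => hk; first by right.
  left; case: (ltP (info P z) b) => hb; first by left; right.
  case: (eqVneq (psi (phi z.1 z.2) z.2) z.1) => he; last by left; left.
  by right.
have SB : mass (P n) S <= 2 * (2 `^ (- d)) ^+ n.
  apply: (le_trans (mass_correct_short_le b k)).
  have -> : (2 ^ k.+1)%:R = 2 * 2 `^ k%:R :> R.
    by rewrite powR_mulrn // expnS natrM natrX.
  have kle : 2 `^ k%:R <= 2 `^ (n%:R * (b - d)) :> R.
    by rewrite ler_powR ?ler1n // truncn_le.
  rewrite mulrCA ler_pM2l //.
  apply: (le_trans (ler_wpM2l (powR_ge0 _ _) kle)).
  rewrite -powR_mulrn ?powR_ge0 // -powRrM -powRD ?pnatr_eq0 ?implybT //.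
  by rewrite le_eqVlt; apply/orP; left; apply/eqP; congr (_ `^ _); ring.
have := @markov_esum _ _ _ (hP n) D (fun z => (size (phi z.1 z.2))%:R) (n%:R * (b - d)) bd0.
move=> /(_ (fun=> ler0n _ _)) H.
have {H} : ((n%:R * (b - d) * mass (P n) D)%:E <= exp_len P phi)%E.
  apply: H => z Dz; apply: (le_trans (ltW (truncnS_gt _))).
  by rewrite ler_nat.
rewrite -(@lee_pmul2l _ (n%:R^-1)%:E) ?lte_fin ?invr_gt0 ?ltr0n //.
apply: le_trans; rewrite -EFinM lee_fin -mulrA mulKf ?pnatr_eq0 -?lt0n //.
by apply: ler_wpM2l; rewrite ?subr_ge0 //; lra.
Qed.

End Converse.

(** * The lower bound in the limit *)

Section ConverseLimit.
Local Open Scope classical_set_scope.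
Variables (R : realType) (X Y : countType) (P : forall n, jpmf R X Y n).
Arguments P : clear implicits.
Hypothesis hP : is_source P.

Lemma achievable_rate_ge0 (eps r : R) : achievable P eps r -> 0 <= r.
Proof.
move=> [phi [psi [_ [_ hlen]]]]; apply/ler_addgt0Pr => e e0.
have [n _ /(_ n (leqnn n))] := near_le_of_limn_esup hlen e0.
rewrite -lee_fin; apply: le_trans; apply: mule_ge0.
  by rewrite lee_fin invr_ge0.
by apply: esum_ge0 => z _; rewrite lee_fin mulr_ge0 // P_ge0.
Qed.

Lemma achievable_rate_ge (eps r b : R) : 0 <= eps -> eps <= 1 ->
  (fun n => @Pr R X Y n P [set z | info P z < b]) @ \oo --> 0%E ->
  achievable P eps r -> (1 - eps) * b <= r.
Proof.
move=> eps0 eps1 hb hr; have r0 := achievable_rate_ge0 hr.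
(* A threshold [b <= 0] follows from nonnegativity of rates; below, [b] is a positive factor. *)
case: (lerP b 0) => [b0|b0].
  by apply: le_trans r0; apply: mulr_ge0_le0 => //; rewrite subr_ge0.
move: hr => [phi [psi [_ [herr hlen]]]].
have key d : 0 < d -> d <= b -> (1 - eps) * (b - d) <= r.
  move=> d0 db; apply/ler_addgt0Pr => e e0.
  (* One share [e'] pays for the length; the error, low-information and counting terms cost one
     share each, multiplied by [b - d <= b]. The total is at most [e]. *)
  pose e' := e / (1 + 3 * b).
  have b3 : 0 < 1 + 3 * b by rewrite ltr_pwDl // mulr_ge0 // ltW.
  have e'0 : 0 < e' by rewrite divr_gt0.
  have x01 : 0 <= 2 `^ (- d) < (1 : R).
    rewrite powR_ge0 /= powR2E expR_lt1 mulNr oppr_lt0.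
    by apply: mulr_gt0 => //; exact: ln2_gt0.
  have : \forall n \near \oo, (1 - eps) * (b - d) <= r + e.
    near=> n.
    have n0 : (0 < n)%N by near: n; exists 1%N.
    have : (err_prob P (phi n) (psi n) <= (eps + e')%:E)%E.
      by near: n; exact: near_le_of_limn_esup herr e'0.
    have : ((n%:R^-1)%:E * exp_len P (phi n) <= (r + e')%:E)%E.
      by near: n; exact: near_le_of_limn_esup hlen e'0.
    have : (@Pr R X Y n P [set z | (info P z < b)%R] <= e'%:E)%E.
      by near: n; exact: near_le_of_cvge0 hb e'0.
    have : 2 * (2 `^ (- d)) ^+ n <= e' by near: n; exact: exprn_near_le.
    rewrite /err_prob !(PrE hP) !lee_fin => h1 h2 h3 h4.
    have := le_trans (exp_len_ge hP n0 (phi n) (psi n) db (ltW d0)) h3.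
    rewrite lee_fin => {h3}; move: h1 h2 h4.
    move: (mass _ _) (mass _ _) (2 * _ ^+ n) => u v w h1 h2 h4 h5.
    have e'E : e = e' + 3 * b * e' by rewrite /e'; field; rewrite gt_eqF.
    have : 0 <= (b - d) * (eps + 3 * e' - u - v - w).
      by rewrite mulr_ge0 ?subr_ge0 //; lra.
    have : 0 <= d * e' by rewrite mulr_ge0 // ltW.
    rewrite e'E; nra.
  by move=> [n _ /(_ n (leqnn n))].
apply/ler_addgt0Pr => e e0.
(* [d <= b] is required by [key], and [d <= e] makes the loss [(1 - eps) * d] at most [e]. *)
pose d := Num.min b e.
have d0 : 0 < d by rewrite lt_min b0 e0.
have := key d d0; rewrite ge_min lexx => /(_ isT) h.
have de : d <= e by rewrite ge_min lexx orbT.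
have : 0 <= eps * d by rewrite mulr_ge0 // ltW.
by nra.
Unshelve. all: by end_near.
Qed.

End ConverseLimit.

(** * Code construction and the upper bound *)

Section Achievability.
Local Open Scope classical_set_scope.

(** The position of an element in an exhaustive list of [A] selects one of the [2 ^ L] words. *)
Lemma exists_fixed_length_code (T : choiceType) (A : set T) (L : nat) :
  (forall s : seq T, uniq s -> (forall x, x \in s -> A x) -> (size s <= 2 ^ L)%N) ->
  exists f : T -> L.-tuple bool, forall x x', A x -> A x' -> f x = f x' -> x = x'.
Proof.
move=> /exists_enum_of_bounded[s [us sA sL]].
exists (fun x => nth (nseq_tuple L false) (enum {: L.-tuple bool}) (index x s)).
move=> x x' /sA xs /sA x's /eqP.
have sz : size (enum {: L.-tuple bool}) = (2 ^ L)%N by rewrite -cardE card_tuple card_bool.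
rewrite nth_uniq ?enum_uniq ?sz ?(leq_trans _ sL) ?index_mem // => /eqP e.
by rewrite -(nth_index x xs) e nth_index.
Qed.

Variables (R : realType) (X Y : countType) (P : forall n, jpmf R X Y n).
Arguments P : clear implicits.
Hypothesis hP : is_source P.

Section Block.
Variable n : nat.
Hypothesis n_gt0 : (0 < n)%N.

(** Each listed sequence carries at least the fraction [2 ^ (- n a)] of the fiber mass. The empty
    list is treated apart: an actual element makes [PY P y] positive, so that it cancels. *)
Lemma size_low_info_fiber (a : R) (y : n.-tuple Y) (s : seq (n.-tuple X)) :
  uniq s -> (forall x, x \in s -> 0 < P n (x, y) /\ info P (x, y) <= a) ->
  (size s)%:R <= 2 `^ (n%:R * a) :> R.
Proof.
move=> us sA; case: s us sA => [|x0 s0]; first by rewrite powR_ge0.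
set s := x0 :: s0 => us sA.
have PY0 : 0 < PY P y.
  have [h _] := sA x0 (mem_head _ _).
  exact: (lt_le_trans h (P_le_PY hP (x0, y))).
have : \sum_(x <- s) 2 `^ (- (n%:R * a)) * PY P y <= PY P y.
  apply: le_trans (sum_fiber_le_PY hP y us).
  rewrite big_seq [leRHS]big_seq; apply: ler_sum => x /sA[Pz].
  by rewrite (info_le hP _ n_gt0 Pz).
rewrite big_const_seq count_predT iter_addr_0 -[leLHS]mulr_natl mulrA.
rewrite -[leRHS]mul1r ler_pM2r // powRN -ler_pdivlMr ?invr_gt0 ?powR_gt0 //.
by rewrite invrK mul1r.
Qed.

Lemma exp_len_const1 : exp_len P (fun (_ : n.-tuple X) (_ : n.-tuple Y) => [:: false]) = 1%E.
Proof. by rewrite /exp_len -(hP n).2; apply: eq_esum => z _; rewrite mulr1. Qed.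

Lemma exp_len_dichotomy (phi : encoder X Y n) (D : set (n.-tuple X * n.-tuple Y)) (L : nat) :
  (forall z, size (phi z.1 z.2) = (L * (z \in D)).+1) ->
  exp_len P phi = (1 + L%:R * mass (P n) D)%:E.
Proof.
move=> h; rewrite EFinD EFinM -(massE (hP n)) -(hP n).2.
have P0 z : (0 <= (P n z)%:E)%E by rewrite lee_fin P_ge0.
rewrite -esumZ // [X in (_ + X)%E]esum_mkcond -esumD //.
  apply: eq_esum => z _; rewrite h -natr1 mulrDr mulr1 EFinD addeC.
  congr (_ + _)%E; case: ifP => _; last by rewrite muln0 mulr0.
  by rewrite muln1 mulrC EFinM.
by move=> z _; case: ifP => // _; apply: mule_ge0.
Qed.

Lemma exists_block_code (a eps : R) : 0 <= a -> 0 <= eps -> eps <= 1 ->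
  exists c : encoder X Y n * decoder X Y n,
  [/\ prefix_free_enc c.1,
      mass (P n) [set z | c.2 (c.1 z.1 z.2) z.2 != z.1]
        <= eps + mass (P n) [set z | info P z > a]
    & (exp_len P c.1 <= (1 + (n%:R * a + 1) * (1 - eps))%:E)%E].
Proof.
move=> a0 eps0 eps1.
(* Null atoms are left out because the fiber count needs positive mass; by [AC] this costs no
   probability. *)
pose A := [set z | 0 < P n z /\ info P z <= a].
have AC : mass (P n) (~` A) <= mass (P n) [set z | info P z > a].
  have zero : mass (P n) [set z | P n z = 0] = 0 by apply: mass_eq0.
  rewrite -[leRHS]addr0 -zero; apply: le_trans (massU_le (hP n) _ _).
  apply: (mass_le (hP n)) => z nA /=.
  case: (ltP a (info P z)) => [|ia]; [by left|right].
  apply/eqP; rewrite eq_le (P_ge0 hP) andbT leNgt; apply/negP => Pz.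
  by apply: nA.
have na0 : 0 <= n%:R * a by rewrite mulr_ge0.
(* If [A] has mass at most [eps], a constant code suffices: its error is at most 1, the mass of [A]
   plus that of its complement. *)
case: (lerP (mass (P n) A) eps) => [Aeps|epsA].
  have [z0 _] : exists z, [set: n.-tuple X * n.-tuple Y] z.
    apply: contrapT => hn; have := massT (hP n).
    rewrite mass_eq0; first by move=> /eqP; rewrite eq_sym oner_eq0.
    by move=> z _; exfalso; apply: hn; exists z.
  exists ((fun _ _ => [:: false]), (fun _ _ => z0.1)); split => //=.
    apply: (le_trans (mass_le1 (hP n) _)).
    have := massC (hP n) A; lra.
  by rewrite exp_len_const1 lee_fin lerDl; apply: mulr_ge0; [exact: addr_ge0|rewrite subr_ge0].
have [G [z0 [Geps epsG GA]]] := exists_critical_atom (hP n) eps0 epsA.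
(* Rounding up gives [2 ^ L >= 2 ^ (n a)], enough words for every fiber, with [L <= n a + 1]. *)
pose L := (Num.truncn (n%:R * a)).+1.
have fibers y : exists f : n.-tuple X -> L.-tuple bool,
    forall x x', A (x, y) -> A (x', y) -> f x = f x' -> x = x'.
  apply: exists_fixed_length_code => s us sA.
  rewrite -(ler_nat R); apply: (le_trans (size_low_info_fiber us sA)).
  rewrite natrX -powR_mulrn // ler_powR ?ler1n //.
  by rewrite ltW // truncnS_gt.
pose f y := sval (cid (fibers y)).
have f_inj y x x' : A (x, y) -> A (x', y) -> f y x = f y x' -> x = x'.
  exact: (svalP (cid (fibers y))).
pose D := A `\` (G `|` [set z0]).
(* The flag bit separates the two kinds of words, and flagged words share one length, hence
   prefix-freeness for each [y]. *)
pose phi (x : n.-tuple X) (y : n.-tuple Y) : seq bool :=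
  if (x, y) \in D then true :: f y x else [:: false].
pose psi (w : seq bool) (y : n.-tuple Y) : n.-tuple X :=
  if w == [:: false] then z0.1 else xget z0.1 [set x | D (x, y) /\ phi x y = w].
exists (phi, psi); split => /=.
- move=> y x x'; rewrite /phi; case: ifP => _; case: ifP => _ //= h.
  by move: h; rewrite prefixE !size_tuple take_oversize ?size_tuple // => /eqP ->.
(* Errors lie in [G] or outside [A]: [z0] is the decoding of the short word, and on [D] the index
   determines [x]. *)
- apply: (@le_trans _ _ (mass (P n) (G `|` ~` A))).
    apply: (mass_le (hP n)) => -[x y] /= /eqP err.
    apply: contrapT => /not_orP[nG /contrapT Az]; apply: err.
    case: (pselect ((x, y) = z0)) => [z0E|nz0].
      have nD : ((x, y) \in D) = false by apply/negP => /set_mem[_]; apply; right.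
      by rewrite /psi /phi nD eqxx -z0E.
    have Dz : D (x, y) by split => // -[].
    have xy : (x, y) \in D by rewrite inE.
    rewrite /psi /phi xy /=.
    have : exists x', D (x', y) /\ phi x' y = true :: f y x.
      by exists x; rewrite /phi xy.
    move=> /(@xgetPex _ z0.1 [set x' | _ ]) [/= Dx].
    rewrite /phi mem_set // => -[/val_inj /f_inj]; apply.
      exact: Dx.1.
    exact: Az.
  apply: (le_trans (massU_le (hP n) _ _)); exact: lerD.
rewrite (exp_len_dichotomy (D := D) (L := L)).
  rewrite lee_fin lerD2l; apply: ler_pM => //; first exact: (mass_ge0 (hP n)).
    by rewrite /L -natr1 lerD2r truncn_le.
  (* Long words avoid both [G] and [z0], whose joint mass exceeds [eps]; the crossing atom yields
     the factor [1 - eps]. *)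
  apply: (@le_trans _ _ (mass (P n) (~` (G `|` [set z0])))).
    by apply: (mass_le (hP n)) => z [].
  by rewrite (massC (hP n)) lerD2l lerN2 ltW.
move=> [x y] /=; rewrite /phi; case: ifP => _ /=; last by rewrite muln0.
by rewrite size_tuple muln1.
Qed.

End Block.

(** Atoms of positive probability have nonnegative information, so a negative threshold would be
    exceeded with probability 1. *)
Lemma info_quantile_ge0 (a : R) :
  (fun n => @Pr R X Y n P [set z | info P z > a]) @ \oo --> 0%E -> 0 <= a.
Proof.
move=> h; rewrite leNgt; apply/negP => a0.
have half0 : 0 < (1 / 2 : R) by lra.
have [N _ HN] := near_le_of_cvge0 h half0.
have := HN N.+1 (leqnSn N); rewrite (PrE hP) lee_fin.
have := massC (hP N.+1) [set z | info P z > a].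
rewrite (mass_eq0 (A := ~` _)) => [e|z /= /negP]; first lra.
rewrite -leNgt => ia; apply/eqP; rewrite eq_le (P_ge0 hP) andbT leNgt.
by apply/negP => /(info_ge0 hP (ltn0Sn N)); lra.
Qed.

Lemma achievable_of_quantile (eps a : R) : 0 <= eps -> eps <= 1 ->
  (fun n => @Pr R X Y n P [set z | info P z > a]) @ \oo --> 0%E ->
  achievable P eps ((1 - eps) * a).
Proof.
move=> eps0 eps1 ha; have a0 := info_quantile_ge0 ha.
have codes n : exists c : encoder X Y n * decoder X Y n,
  prefix_free_enc c.1 /\ ((0 < n)%N ->
      mass (P n) [set z | c.2 (c.1 z.1 z.2) z.2 != z.1]
        <= eps + mass (P n) [set z | info P z > a]
    /\ (exp_len P c.1 <= (1 + (n%:R * a + 1) * (1 - eps))%:E)%E).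
  (* Blocklength 0 does not affect the limits; any prefix-free code serves there. *)
  case: n => [|n].
    by exists ((fun _ _ => [:: false]), (fun _ _ => [tuple])).
  have [c [h1 h2 h3]] := exists_block_code (ltn0Sn n) a0 eps0 eps1.
  by exists c.
pose c n := sval (cid (codes n)); have cP n := svalP (cid (codes n)).
exists (fun n => (c n).1), (fun n => (c n).2); split; first by move=> n; exact: (cP n).1.
split; apply: limn_esup_le_of_near => e e0.
  near=> n.
  have n0 : (0 < n)%N by near: n; exists 1%N.
  have : (@Pr R X Y n P [set z | (info P z > a)%R] <= e%:E)%E.
    by near: n; exact: near_le_of_cvge0 ha e0.
  have [h _] := (cP n).2 n0.
  by rewrite /err_prob !(PrE hP) !lee_fin => h'; apply: (le_trans h); rewrite lerD2l.
near=> n.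
have n0 : (0 < n)%N by near: n; exists 1%N.
have [_ h] := (cP n).2 n0.
have nR : 0 < n%:R :> R by rewrite ltr0n.
(* The overhead is one flag bit plus at most [1 - eps <= 1] from rounding [L], so 2 bits are
   absorbed by [n e]. *)
have ne : 2 <= n%:R * e.
  rewrite -ler_pdivrMr //; near: n; exact: nbhs_infty_ger.
apply: (@le_trans _ _ ((n%:R^-1)%:E * (1 + (n%:R * a + 1) * (1 - eps))%:E)%E).
  by apply: lee_wpmul2l; rewrite ?lee_fin ?invr_ge0 // ltW.
rewrite -EFinM lee_fin ler_pdivrMl //; nra.
Unshelve. all: by end_near.
Qed.

End Achievability.

(** * Passage to extremal rates and thresholds *)

Theorem theorem6 (R : realType) (X Y : countType) (P : forall n, jpmf R X Y n)
  (hP : is_source P) (eps : R) (heps0 : 0 <= eps) (heps1 : eps < 1) :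
  (((1 - eps)%:E * cond_ent_inf P <= Rcom P eps)%E /\
   (Rcom P eps <= (1 - eps)%:E * cond_ent_sup P)%E).
Proof.
have eps'0 : 0 < 1 - eps by rewrite subr_gt0.
split.
  apply: le_ereal_inf_tmp => _ [r hr <-].
  rewrite -ereal_sup_pZl //; apply: ge_ereal_sup => _ [_ [b hb <-] <-].
  by rewrite -EFinM lee_fin; exact: (achievable_rate_ge hP heps0 (ltW heps1) hb hr).
rewrite -lee_pdivrMl //; apply: le_ereal_inf_tmp => _ [a ha <-].
rewrite lee_pdivrMl // -EFinM; apply: ereal_inf_lbound.
by exists ((1 - eps) * a) => //; exact: (achievable_of_quantile hP heps0 (ltW heps1) ha).
Qed.
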